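(* Let $G$ be a chordless graph. Then either $G$ is sparse, or $G$ admits a 1-cutset, or $G$ admits a proper 2-cutset.
   Context: A graph is chordless if none of its cycles (as subgraphs) has a chord. A graph is sparse if no two vertices of degree at least 3 are adjacent. A $k$-cutset is a set $S\subseteq V(G)$ of size $k$ such that $G\setminus S$ is disconnected. A 2-cutset $\{a,b\}$ is proper if $a\neq b$, $ab\notin E(G)$, $V(G)\setminus\{a,b\}$ can be partitioned into non-empty sets $X,Y$ with no edge between $X$ and $Y$, and neither $G[X\cup\{a,b\}]$ nor $G[Y\cup\{a,b\}]$ is a path from $a$ to $b$. *)

(* Defs.v *)
From HB Require Import structures.
From mathcomp Require Import all_boot.

Set Implicit Arguments.
Unset Strict Implicit.
Unset Printing Implicit Defensive.

(* A finite simple graph on the vertex set T is a symmetric irreflexive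
   relation e : rel T; these two properties are hypotheses of the theorems. *)

Section Graph.

Variables (T : finType) (e : rel T).

Definition degree (x : T) : nat := #|[set y | e x y]|.

(* A cycle of the graph is a duplicate-free cyclic sequence of at least three
   vertices; its edges are the pairs {x, next c x}. *)
Definition graph_cycle (c : seq T) : Prop := ucycle e c /\ 2 < size c.

Definition is_chord (c : seq T) (x y : T) : Prop :=
  [/\ x \in c, y \in c, e x y, y != next c x & x != next c y].

Definition chordless : Prop :=
  forall c : seq T, graph_cycle c -> ~ exists x y : T, is_chord c x y.

Definition sparse : Prop :=
  forall x y : T, 3 <= degree x -> 3 <= degree y -> ~~ e x y.

Definition induced (A : {set T}) : rel T :=
  [rel x y | [&& x \in A, y \in A & e x y]].

(* The graph induced on A is disconnected; in particular A has at least two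
   vertices, so the empty graph is not disconnected. *)
Definition disconnected (A : {set T}) : Prop :=
  exists x y : T, [/\ x \in A, y \in A & ~~ connect (induced A) x y].

Definition cutset (k : nat) (S : {set T}) : Prop :=
  #|S| = k /\ disconnected (~: S).

(* The whole induced graph on A is a path with ends a and b: the vertices of A
   are listed without repetition from a to b, and two of them are adjacent
   exactly when they are consecutive in the list. *)
Definition induces_path (A : {set T}) (a b : T) : Prop :=
  exists p : seq T, let s := a :: p in
    [/\ uniq s, last a p = b, A =i s &
        {in A &, forall x y, e x y =
           (index y s == (index x s).+1) || (index x s == (index y s).+1)}].

Definition proper_2cutset (a b : T) : Prop :=
  [/\ cutset 2 [set a; b], a != b, ~~ e a b &
      exists X Y : {set T},
        [/\ X :|: Y = ~: [set a; b], [disjoint X & Y], X != set0 & Y != set0] /\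
        [/\ {in X & Y, forall x y, ~~ e x y},
            ~ induces_path (X :|: [set a; b]) a b &
            ~ induces_path (Y :|: [set a; b]) a b]].

End Graph.

(* Main.v *)
Require Import Defs.
From mathcomp Require Import all_boot zify.

Set Implicit Arguments.
Unset Strict Implicit.
Unset Printing Implicit Defensive.

(** Suppose that [G] has no cut vertex and let [xy] be an edge whose ends have
    degree at least 3.  If no vertex separates [x] from [y] in [G - xy], then
    [G - xy] has no cut vertex either, so by Whitney's theorem it contains two
    internally disjoint paths from [x] to [y]; they form a cycle of [G] with
    chord [xy].  Hence some [z] separates [G - xy - z] into [X] containing [x]
    and [Y] containing [y].  Then [{x, z}] is a proper 2-cutset: a path through
    [X] and a path through [Y], both from [x] to [z], would give a cycle with
    chord [xz] if [x] and [z] were adjacent, and neither side is a path because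
    [x] keeps two neighbours in [X + z] and [y] keeps three in [Y + x + z]. *)

(** * Disjoint paths, chords and Whitney's theorem *)

Section Paths.

Variables (T : finType) (e : rel T).

(* [p] and [q] list the interior vertices of the two paths; if [x] and [v] are
   adjacent, both may be empty. *)
Definition disjoint_paths (x v : T) (p q : seq T) : bool :=
  [&& path e x (rcons p v), path e x (rcons q v) & uniq [:: x, v & p ++ q]].

Lemma disjoint_pathsC x v p q :
  disjoint_paths x v p q = disjoint_paths x v q p.
Proof.
by rewrite /disjoint_paths /= !inE !mem_cat uniq_catC andbCA (orbC (x \in p))
  (orbC (v \in p)).
Qed.

(** Shorten a path from [w] to [t] to a duplicate-free one and stop at its first vertex [r] outside
    [B]. *)
Lemma first_exit (A : {set T}) (B : {pred T}) w t :
    connect (induced e A) w t -> w \in B -> t \notin B ->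
  exists s r, [/\ path e w (rcons s r), {subset rcons s r <= A},
    {subset w :: s <= B}, r \notin B & uniq (w :: s)].
Proof.
move=> /connectP[s0 /shortenP[s es Us _] -> {s0 t}] wB lastB.
have hasB : has (predC (mem B)) s.
  apply/hasP; exists (last w s) => //.
  by have := mem_last w s; rewrite inE => /predU1P[lw|//]; rewrite lw wB in lastB.
case: (split_find hasB) es Us => r s1 s2 rB s1B.
rewrite -cat_cons cat_path cat_uniq -rcons_cons rcons_uniq.
move=> /andP[es1 _] /andP[/andP[_ Us1] _].
exists s1, r; split=> //.
- by apply: sub_path es1 => u v /and3P[].
- move: (rcons s1 r) es1 => {rB s1B Us1 wB lastB hasB} s1' es1 u.
  elim: s1' w es1 => //= v s1' IH w /andP[/and3P[_ vA _]] /IH {}IH.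
  by rewrite inE => /predU1P[->|].
- move=> u; rewrite inE => /predU1P[->//|us1].
  by move/hasPn: s1B => /(_ u us1); rewrite /= negbK.
Qed.

Hypothesis e_sym : symmetric e.

Lemma induced_connect_sym (A : {set T}) : connect_sym (induced e A).
Proof.
by apply: sym_connect_sym => u v; rewrite /induced /= e_sym andbCA.
Qed.

Lemma path_rev_rcons w s r :
  path e w (rcons s r) = path e r (rcons (rev s) w).
Proof.
have := rev_path e w (rcons s r); rewrite last_rcons belast_rcons rev_cons => ->.
by apply: eq_path => u v; rewrite e_sym.
Qed.

(** Following [p] from [x] to [z] and [q] backwards closes a cycle. As both interiors are nonempty,
    [x] and [z] are not consecutive on it, so the edge [xz] is a chord. *)
Lemma no_chord_disjoint_paths x z p q : chordless e -> e x z ->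
  disjoint_paths x z p q -> p != [::] -> q != [::] -> False.
Proof.
move=> Ch exz /and3P[ep eq U] p0 q0.
have eq' : path e z (rcons (rev q) x) by rewrite -path_rev_rcons.
have Uc : uniq (x :: p ++ z :: rev q).
  rewrite -(perm_uniq (s1 := [:: x, z & p ++ q])) //.
  rewrite perm_cons -cat1s perm_catCA /= perm_cat2l perm_cons.
  by rewrite perm_sym perm_rev.
apply: (Ch (x :: p ++ z :: rev q)).
  split; last by case: p p0 {ep U Uc} => //= a p _; rewrite size_cat /= addnS.
  rewrite /ucycle Uc andbT /= rcons_cat rcons_cons -cat_rcons.
  by rewrite cat_path last_rcons ep.
exists x, z; split=> //.
- exact: mem_head.
- by rewrite inE mem_cat mem_head !orbT.
- case: p p0 U {ep Uc} => //= a p _; rewrite eqxx !inE /=.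
  by case/and3P=> _ /norP[+ _] _.
- rewrite -(next_rot (size (x :: p)) Uc) -cat_cons rot_size_cat.
  have: x \notin rev q.
    by move: U; rewrite /= !inE mem_cat mem_rev => /andP[/norP[_ /norP[]]].
  have: rev q != [::] by rewrite -size_eq0 size_rev size_eq0.
  by case: (rev q) => //= a r _; rewrite eqxx inE => /norP[].
Qed.

(** The induction step of Whitney's theorem, moving the common end from [v] to its neighbour [w]. A
    path from [w] that avoids [v] is followed until it first meets [x], [p] or [q]; the path met
    there is diverted to [w], and the other one continues through [v] to [w]. *)
Lemma disjoint_paths_step x v w p q :
    irreflexive e ->
    connect (induced e (~: [set v])) w x ->
    disjoint_paths x v p q -> e v w -> w != x ->
  exists p' q', disjoint_paths x w p' q'.
Proof.
move=> e_irr Cwx D evw wx.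
have vw : v != w by apply: contraTneq evw => ->; rewrite e_irr.
(* If [w] is already on one path, that path stops at [w], while the other goes on to [v] and returns
   along [p2] to [w]. *)
have reroute p1 p2 q1 : disjoint_paths x v (p1 ++ w :: p2) q1 ->
    exists p' q', disjoint_paths x w p' q'.
  case/and3P; rewrite -cat_rcons rcons_cat cat_path last_rcons.
  move=> /andP[ep1 ep2] eq1 U; exists p1, (q1 ++ v :: rev p2).
  apply/and3P; split=> //.
    rewrite -cat_rcons rcons_cat cat_path eq1 last_rcons.
    by rewrite -path_rev_rcons.
  rewrite -(perm_uniq (s1 := [:: x, v & rcons p1 w ++ p2 ++ q1])) ?catA //.
  apply/permP=> a; rewrite /= !count_cat /= count_rev -cats1 !count_cat /=.
  by lia.
(* The second path is [q1] prolonged by the edge [vw]; only a new first path with interior [p2] has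
   to be supplied. *)
have extend p1 q1 : disjoint_paths x v p1 q1 -> forall p2,
    path e x (rcons p2 w) -> uniq p2 -> w \notin q1 ->
    {in p2, forall u, [/\ u != x, u != v, u != w & u \notin q1]} ->
    exists p' q', disjoint_paths x w p' q'.
  case/and3P=> _ eq1 U p2 ep2 Up2 wq p2P.
  exists p2, (rcons q1 v); apply/and3P; split=> //.
    by rewrite rcons_path eq1 last_rcons.
  move: U; rewrite /= !inE !mem_cat !mem_rcons !inE !cat_uniq rcons_uniq Up2 /=.
  rewrite !negb_or => /and3P[/and3P[xv _ xq] /andP[_ vq] /and3P[_ _ Uq]].
  rewrite (eq_sym x w) wx xv xq wq vq Uq (eq_sym w v) vw !andbT /=.
  have nx : x \notin p2 by apply/negP=> /p2P[]; rewrite eqxx.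
  have nw : w \notin p2 by apply/negP=> /p2P[]; rewrite eqxx.
  rewrite nx nw /=; apply/hasPn=> u; rewrite mem_rcons inE => uq.
  apply/negP=> /p2P[_ uv _ uq1]; move: uq.
  by rewrite (negPf uv) (negPf uq1).
have [wp|wp] := boolP (w \in p).
  by case/splitPr: wp D => p1 p2; apply: reroute.
have [wq|wq] := boolP (w \in q).
  by move: D; rewrite disjoint_pathsC; case/splitPr: wq => q1 q2; apply: reroute.
pose B := [predC x :: p ++ q].
have wB : w \in B by rewrite !inE mem_cat (negPf wx) (negPf wp) (negPf wq).
have xB : x \notin B by rewrite !inE eqxx.
have [s [r [es sA sB rB]]] := first_exit Cwx wB xB.
rewrite /= => /andP[ws Us].
have es' : path e r (rcons (rev s) w) by rewrite -path_rev_rcons.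
have sP u : u \in rev s -> [/\ u != x, u != v, u != w, u \notin p & u \notin q].
  rewrite mem_rev => us.
  have /sB : u \in w :: s by rewrite inE us orbT.
  rewrite !inE mem_cat !negb_or => /and3P[-> -> ->]; split=> //.
    by have := sA u; rewrite mem_rcons !inE us orbT => ->.
  by apply: contraNneq ws => <-.
(* The new first path follows [p1] up to [r], then runs along [s] backwards to [w]. *)
have attach p1 q1 : disjoint_paths x v p1 q1 -> r \in p1 -> w \notin p1 ->
    w \notin q1 ->
    {in rev s, forall u,
      [/\ u != x, u != v, u != w, u \notin p1 & u \notin q1]} ->
    exists p' q', disjoint_paths x w p' q'.
  move=> D1 rp; case/splitPr: rp D1 => p1a p1b D1 wp1 wq1 sP1.
  have [ep1 _ U1] := and3P D1.
  move: U1; rewrite /= !inE !mem_cat !inE !negb_or -!catA /= => U1.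
  apply: (extend _ _ D1 (p1a ++ r :: rev s)) => //.
  - move: ep1; rewrite !rcons_cat !cat_path /= => /and3P[-> -> _] /=.
    exact: es'.
  - have [_ _] := and3P U1; rewrite !cat_uniq /= rev_uniq Us !negb_or.
    case/and3P=> -> /andP[-> _] _; rewrite andbT /=; apply/andP; split.
      by apply/hasPn=> u /sP1[_ _ _]; rewrite mem_cat negb_or => /andP[].
    by apply/negP=> /sP1[_ _ _]; rewrite mem_cat mem_head orbT.
  - move=> u; rewrite mem_cat inE orbA => /orP[up|/sP1[]//].
    have upp : u \in p1a ++ r :: p1b by rewrite mem_cat inE orbA up.
    have [_ _] := and3P D1; rewrite /= inE negb_or !mem_cat.
    rewrite cat_uniq => /and3P[/andP[_ xn] vn /and3P[_ /hasPn Hn _]].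
    split.
    + by apply: contraNneq xn => <-; rewrite -mem_cat upp.
    + by apply: contraNneq vn => <-; rewrite -mem_cat upp.
    + by apply: contraNneq wp1 => <-.
    + by apply/negP=> /Hn; rewrite /= upp.
move: rB; rewrite !inE mem_cat negbK => /or3P[/eqP rx|rp|rq].
- apply: (extend _ _ D (rev s)); rewrite ?rev_uniq -?rx //.
  by rewrite rx; move=> u /sP[].
- exact: attach D rp wp wq sP.
- rewrite disjoint_pathsC in D; apply: attach D rq wq wp _ => u /sP[*].
  by split.
Qed.

(** Induction along a path from [x] to [y], carrying the two disjoint paths from each vertex to the
    next. *)
Lemma whitney_disjoint_paths x y :
    irreflexive e ->
    (forall v a b, a != v -> b != v -> connect (induced e (~: [set v])) a b) ->
    connect e x y -> x != y ->
  exists p q, disjoint_paths x y p q.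
Proof.
move=> e_irr conn /connectP[s0 /shortenP[s es Us _] -> {s0 y}].
elim/last_ind: s es Us => [|s w IH]; first by rewrite eqxx.
rewrite rcons_path last_rcons -rcons_cons rcons_uniq.
move=> /andP[es esw] /andP[ws Us] xw.
have wx : w != x by rewrite eq_sym.
(* When [w] comes right after [x], the edge [xw] serves as both paths, with empty interiors. *)
have [lx|lx] := eqVneq x (last x s).
  by exists [::], [::]; rewrite /disjoint_paths /= inE xw {1 2}lx esw.
have [p [q D]] := IH es Us lx.
apply: disjoint_paths_step D esw wx => //; apply: conn => //.
by apply: contraNneq ws => ->; exact: mem_last.
Qed.

End Paths.

(** * The cutset arising from an edge between two vertices of degree at least 3 *)

Section ChordlessGraph.

Variables (T : finType) (e : rel T).
Hypotheses (e_sym : symmetric e) (e_irr : irreflexive e).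

(** On an induced path only the predecessor and the successor of [v] are neighbours, and the first
    vertex [a] has no predecessor. *)
Lemma induces_path_degree (A : {set T}) a b v : induces_path e A a b ->
  v \in A -> #|[set w in A | e v w]| <= (v != a).+1.
Proof.
case=> p [Us _ As eE] vA; set s := a :: p in Us As eE.
(* For the last vertex the successor index is out of range and [nth] returns [a]; this is harmless,
   since [N] only bounds the neighbourhood from above. *)
pose N := nth a s (index v s).+1 |:
  (if v == a then set0 else [set nth a s (index v s).-1]).
apply: (@leq_trans #|N|); last first.
  rewrite /N; case: (v == a); first by rewrite setU0 cards1.
  by rewrite cards2; case: (_ != _).
apply/subset_leq_card/subsetP=> w; rewrite inE => /andP[wA].
rewrite eE // => /orP[]/eqP iw; rewrite !inE.
  by rewrite -iw nth_index ?eqxx // -As.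
have -> : (v == a) = false.
  by apply: contra_eqF iw => /eqP->; rewrite /= eqxx.
by rewrite inE iw /= nth_index ?eqxx ?orbT // -As.
Qed.

Definition del_edge x y : rel T :=
  [rel u v | e u v && ~~ ((u == x) && (v == y) || (u == y) && (v == x))].

Lemma del_edge_sym x y : symmetric (del_edge x y).
Proof.
by move=> u v; rewrite /del_edge /= e_sym orbC (andbC (u == y)) (andbC (u == x)).
Qed.

Hypothesis e_chordless : chordless e.
Hypothesis e_conn : forall v a b,
  a != v -> b != v -> connect (induced e (~: [set v])) a b.

Variables x y : T.
Hypotheses (exy : e x y) (dx : 3 <= degree e x) (dy : 3 <= degree e y).

Lemma degree_neighbor u a b : 3 <= degree e u ->
  exists w, [/\ e u w, w != a & w != b].
Proof.
move=> du; have: ~~ ([set w | e u w] \subset [set a; b]).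
  apply: contraL du => /subset_leq_card; rewrite -ltnNge ltnS /degree.
  by move/leq_trans; apply; rewrite cards2; case: (_ != _).
by case/subsetPn=> w; rewrite !inE negb_or => euw /andP[? ?]; exists w.
Qed.

Lemma edge_separator : exists z, [/\ z != x, z != y &
  ~~ connect (induced (del_edge x y) (~: [set z])) x y].
Proof.
have [/existsP[z /and3P[zx zy Cz]]|] := boolP [exists z, [&& z != x, z != y &
  ~~ connect (induced (del_edge x y) (~: [set z])) x y]]; first by exists z.
rewrite negb_exists => /forallP no_sep; exfalso.
have xy : x != y by apply: contraTneq exy => ->; rewrite e_irr.
have sepxy z : z != x -> z != y ->
    connect (induced (del_edge x y) (~: [set z])) x y.
  by move=> zx zy; have := no_sep z; rewrite zx zy negbK.
(* A connection in the graph minus [v] may use the edge [xy] only if [v] is neither end; that edge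
   is then replaced by a detour given by [sepxy]. *)
have conn v a b : a != v -> b != v ->
    connect (induced (del_edge x y) (~: [set v])) a b.
  move=> av bv; move: (e_conn av bv); apply: connect_sub => u w.
  rewrite /induced /= !inE => /and3P[uv wv euw].
  have [/orP[]/andP[/eqP uE /eqP wE]|ne] :=
    boolP ((u == x) && (w == y) || (u == y) && (w == x)).
  - by subst u w; apply: sepxy; rewrite eq_sym.
  - subst u w; rewrite (induced_connect_sym (@del_edge_sym x y)).
    by apply: sepxy; rewrite eq_sym.
  - by apply: connect1; rewrite /induced /del_edge /= !inE uv wv euw ne.
(* The degree of [x] supplies some vertex [z] other than [x] and [y], to which [sepxy] applies. *)
have Cxy : connect (del_edge x y) x y.
  have [z [_ zx zy]] := degree_neighbor x y dx.
  apply: connect_sub (sepxy z zx zy) => u w /and3P[_ _ guw].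
  exact: connect1.
have girr : irreflexive (del_edge x y) by move=> u; rewrite /del_edge /= e_irr.
have [p [q D]] := whitney_disjoint_paths (@del_edge_sym x y) girr conn Cxy xy.
have p0 r : path (del_edge x y) x (rcons r y) -> r != [::].
  by case: r => //=; rewrite /del_edge /= !eqxx andbF.
have [gp gq U] := and3P D.
apply: (no_chord_disjoint_paths e_sym e_chordless exy _ (p0 _ gp) (p0 _ gq)).
have sub : subrel (del_edge x y) e by move=> u v /andP[].
by rewrite /disjoint_paths (sub_path sub gp) (sub_path sub gq).
Qed.

Lemma edge_separator_proper_2cutset z : z != x -> z != y ->
    ~~ connect (induced (del_edge x y) (~: [set z])) x y ->
  proper_2cutset e x z.
Proof.
set g := del_edge x y => zx zy sep.
have xy : x != y by apply: contraTneq exy => ->; rewrite e_irr.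
(* [X] is the component of [x] once [xy] and [z] are deleted; [Y] collects all remaining vertices
   except [z]. *)
pose X := [set v | (v != z) && connect (induced g (~: [set z])) x v].
pose Y := ~: (z |: X).
have xX : x \in X by rewrite inE eq_sym zx connect0.
have zX : z \notin X by rewrite inE eqxx.
have zY : z \notin Y by rewrite !inE eqxx.
have yX : y \notin X by rewrite inE (negPf sep) andbF.
have yY : y \in Y by rewrite inE in_setU1 negb_or eq_sym zy.
have YP u : u \in Y -> (u != z) /\ (u \notin X).
  by rewrite inE in_setU1 negb_or => /andP[].
(* Any edge from [X] to [Y] other than [xy] would enlarge the component [X]. *)
have cross u v : u \in X -> v \in Y -> e u v -> u = x /\ v = y.
  move=> uX /YP[vz vX] euv.
  have [/orP[]/andP[/eqP uE /eqP vE]|ne] :=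
    boolP ((u == x) && (v == y) || (u == y) && (v == x)).
  - by [].
  - by rewrite vE xX in vX.
  case/negP: vX; move: uX; rewrite inE => /andP[uz Cu]; rewrite inE vz.
  apply: connect_trans Cu (connect1 _).
  by rewrite /induced /g /del_edge /= !inE uz vz euv ne.
have [x' [exx' x'y x'z]] := degree_neighbor y z dx.
have x'x : x' != x by apply: contraTneq exx' => ->; rewrite e_irr.
have x'X : x' \in X.
  apply: contraNT x'y => x'X.
  have [|_ ->//] := cross _ x' xX _ exx'.
  by rewrite inE in_setU1 negb_or x'z.
have nxz : ~~ e x z.
  apply/negP=> exz.
  have [s [r [es sA sB rB Us]]] := first_exit (e_conn x'x zx) x'X zX.
  (* Leaving [X] other than at [z] would use the edge [xy], but the path avoids [x]. *)
  have rz : r = z.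
    apply: contraNeq rB => rz.
    apply: contraTT isT => rX.
    have elr : e (last x' s) r by move: es; rewrite rcons_path => /andP[].
    have [||lx _] := cross (last x' s) r _ _ elr.
    - exact: sB (mem_last _ _).
    - by rewrite inE in_setU1 negb_or rz.
    have := mem_last x' s; rewrite lx inE eq_sym (negPf x'x) /= => xs.
    by have := sA x; rewrite mem_rcons inE xs orbT !inE eqxx => /(_ isT).
  have yx : y != x by rewrite eq_sym.
  have [s2 [r2 [es2 s2A s2B r2B Us2]]] := first_exit (e_conn yx zx) yY zY.
  have rz2 : r2 = z.
    apply: contraNeq r2B => r2z.
    apply: contraTT isT => r2Y.
    have r2X : r2 \in X.
      by apply: contraNT r2Y => r2X; rewrite inE in_setU1 negb_or r2z.
    have elr : e r2 (last y s2).
      by rewrite e_sym; move: es2; rewrite rcons_path => /andP[].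
    have [||r2x _] := cross r2 (last y s2) _ _ elr => //.
    - exact: s2B (mem_last _ _).
    by have := s2A r2; rewrite mem_rcons inE eqxx r2x !inE eqxx => /(_ isT).
  subst r r2.
  apply: (no_chord_disjoint_paths e_sym e_chordless exz
            (p := x' :: s) (q := y :: s2)) => //.
  apply/and3P; split; first by rewrite /= exx'.
    by rewrite /= exy.
  have nx u t : {subset rcons t u <= ~: [set x]} -> x \notin t.
    move=> tA; apply/negP=> xt; have := tA x.
    by rewrite mem_rcons inE xt orbT !inE eqxx => /(_ isT).
  rewrite cons_uniq in_cons mem_cat !in_cons !negb_or (eq_sym x z) zx.
  rewrite (eq_sym x x') x'x (nx _ _ sA) xy (nx _ _ s2A) /=.
  apply/(@andP (z \notin (x' :: s) ++ y :: s2) (uniq ((x' :: s) ++ y :: s2))).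
  split.
    rewrite mem_cat negb_or; apply/andP; split; first by apply: contra zX => /sB.
    by apply: contra zY => /s2B.
  rewrite cat_uniq Us Us2 andbT.
  by apply/hasPn=> u /s2B/YP[_]; apply: contra => /sB.
have xz : x != z by rewrite eq_sym.
(* Of the neighbours of [x] only [y] is lost on the side of [X], so at least two remain, too many
   for the end of a path. *)
have xE :
  y |: [set w in X :\ x :|: [set x; z] | e x w] = [set w | e x w].
  apply/setP=> w; rewrite in_setU1 in_set [RHS]in_set in_setU in_setD1 in_set2.
  have [->|wy] := eqVneq w y; first by rewrite exy.
  rewrite /=; case: (boolP (e x w)) => [exw|]; rewrite ?andbF ?andbT //.
  have [->|wx] //= := eqVneq w x.
  have [->|wz] //= := eqVneq w z; first by rewrite orbT.
  rewrite orbF; apply: contraNT wy => wX.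
  have [|_ ->//] := cross x w xX _ exw.
  by rewrite inE in_setU1 negb_or wz.
(* All neighbours of [y] lie on its side, and three are too many for any vertex of a path. *)
have yE : [set w | e y w] = [set w in Y :|: [set x; z] | e y w].
  apply/setP=> w; rewrite in_set [RHS]in_set in_setU in_set2.
  case: (boolP (e y w)) => [eyw|]; rewrite ?andbF ?andbT //.
  have [->|wx] := eqVneq w x; first by rewrite orbT.
  have [->|wz] := eqVneq w z; first by rewrite !orbT.
  rewrite /= orbF; symmetry; apply: contraNT wx => wY.
  have wX : w \in X.
    by apply: contraNT wY => wX; rewrite inE in_setU1 negb_or wz.
  by have [|-> //] := cross w y wX yY; rewrite e_sym.
split=> //.
- split; first by rewrite cards2 xz.
  exists x', y.
  rewrite !in_setC !in_set2 !negb_or x'x x'z (eq_sym y x) xy (eq_sym y z) zy.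
  split=> //; apply/negP.
  (* The only edge from [X] to [Y] has end [x], so [X] is closed under adjacency once [x] and [z]
     are removed. *)
  have cl : closed (induced e (~: [set x; z])) (mem X).
    apply: intro_closed => [|u v]; first exact: induced_connect_sym.
    rewrite /induced /= !in_setC !in_set2 !negb_or.
    move=> /and3P[/andP[ux uz] /andP[vx vz] euv] uX.
    apply: contraNT ux => vX.
    have [||-> //] := cross u v _ _ euv => //.
    by rewrite inE in_setU1 negb_or vz.
  by move/(closed_connect cl); rewrite /= x'X (negPf yX).
- exists (X :\ x), Y; split; split.
  + apply/setP=> w; rewrite in_setU in_setD1 in_setC in_set2 in_setC in_setU1.
    have [->|wx] := eqVneq w x; first by rewrite xX orbT.
    have [->|wz] := eqVneq w z; first by rewrite (negPf zX).
    by rewrite orbN.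
  + rewrite disjoint_sym disjoint_subset; apply/subsetP=> u /YP[_ uX].
    by rewrite inE in_setD1 negb_and uX orbT.
  + by apply/set0Pn; exists x'; rewrite in_setD1 x'x.
  + by apply/set0Pn; exists y.
  + move=> u v; rewrite in_setD1 => /andP[ux uX] vY; apply: contra ux => euv.
    by have [-> _] := cross u v uX vY euv.
  + move=> /(@induces_path_degree _ _ _ x); rewrite in_setU in_set2 !eqxx orbT.
    move=> /(_ isT) le1.
    move: dx; rewrite /degree -xE => /leq_trans/(_ (leq_card_setU _ _)).
    by rewrite cards1 ltnS ltnNge le1.
  + move=> /(@induces_path_degree _ _ _ y); rewrite in_setU yY -yE.
    move=> /(_ isT) le2.
    by move: dy; rewrite /degree ltnNge (leq_trans le2) //; case: (_ != _).
Qed.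

End ChordlessGraph.

Theorem mainTheorem9 (T : finType) (e : rel T)
    (e_sym : symmetric e) (e_irr : irreflexive e) (G_chordless : chordless e) :
  [\/ sparse e,
      exists S : {set T}, cutset e 1 S |
      exists a b : T, proper_2cutset e a b].
Proof.
(* Either some vertex [v] leaves two others disconnected, and [[set v]] is a 1-cutset, or no vertex
   does. *)
have [/forallP conn|] := boolP [forall v, forall a, forall b,
  (a != v) ==> (b != v) ==> connect (induced e (~: [set v])) a b]; last first.
  case/forallPn=> v /forallPn[a /forallPn[b]].
  rewrite !negb_imply => /and3P[av bv nC]; constructor 2.
  by exists [set v]; split; [rewrite cards1|exists a, b; rewrite !inE].
have e_conn v a b : a != v -> b != v -> connect (induced e (~: [set v])) a b.
  by move=> av bv; have /forallP/(_ a)/forallP/(_ b) := conn v; rewrite av bv.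
have [/existsP[x /existsP[y /and3P[dx dy exy]]]|] := boolP [exists x,
  exists y, [&& 3 <= degree e x, 3 <= degree e y & e x y]].
  have [z [zx zy sep]] :=
    edge_separator e_sym e_irr G_chordless e_conn exy dx.
  constructor 3; exists x, z.
  exact: (@edge_separator_proper_2cutset _ e _ _ _ _ x y).
move=> none; constructor 1 => x y dx dy; apply: contra none => exy.
by apply/existsP; exists x; apply/existsP; exists y; apply/and3P.
Qed.
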